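(* Let $G=(V,E)$ be a finite, simple, undirected graph. Then for every integer $k\ge 1$, $$\sum_{q_k\in\Delta_k(G)} val_G(q_k) = (k+1)\,c_{k+1}(G).$$
   Context: For a vertex $v\in V(G)$, $N_G(v)$ denotes the open neighborhood of $v$, i.e. the set of vertices adjacent to $v$. A $k$-clique of $G$ is a complete subgraph of $G$ on $k$ vertices. $\Delta_k(G)$ denotes the set of all $k$-cliques of $G$, and $c_k(G)$ denotes the number of $k$-cliques of $G$. For a $k$-clique $q_k$ of $G$ with vertex set $V(q_k)$, its value is $$val_G(q_k)=\Big|\bigcap_{v\in V(q_k)} N_G(v)\Big|.$$ For $k=1$ this is the degree of the vertex. *)

(* Defs.v *)
(* MathComp.  A finite simple undirected graph is a symmetric irreflexive
   adjacency relation on a finite vertex type. *)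
From mathcomp Require Import all_boot.

Set Implicit Arguments.
Unset Strict Implicit.
Unset Printing Implicit Defensive.

Record sgraph := SGraph {
  vertex : finType;
  adj : rel vertex;
  adj_sym : symmetric adj;
  adj_irrefl : irreflexive adj
}.

Definition nbhd (G : sgraph) (v : vertex G) : {set vertex G} :=
  [set w | adj v w].

(* A complete subgraph is determined by its vertex set, so cliques are
   represented by their vertex sets. *)
Definition is_clique (G : sgraph) (q : {set vertex G}) : bool :=
  [forall x in q, forall y in q, (x != y) ==> adj x y].

Definition cliques (G : sgraph) (k : nat) : {set {set vertex G}} :=
  [set q | is_clique q & #|q| == k].

Definition num_cliques (G : sgraph) (k : nat) : nat := #|cliques G k|.

Definition clique_val (G : sgraph) (q : {set vertex G}) : nat :=
  #|\bigcap_(v in q) nbhd v|.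

(* Main.v *)
Require Import Defs.
From mathcomp Require Import all_boot.

(** Both sides count the pairs (r, w) where r is a (k+1)-clique and w is one of
    its vertices.  Grouping by r gives k+1 pairs for each clique.  Grouping by
    the k-clique q = r minus w gives the other side, because a vertex w extends
    q to a larger clique exactly when it is adjacent to all of q
    ([is_clique_setU1]); so each q occurs with clique_val q choices of w.  The
    sums are compared one vertex w at a time ([sum_cliques_at_vertex]). *)

Lemma is_cliqueP (G : sgraph) (q : {set vertex G}) :
  reflect {in q &, forall x y, x != y -> adj x y} (is_clique q).
Proof.
apply: (iffP forall_inP) => [cl x y xq yq | cl x xq].
  by move/forall_inP: (cl x xq) => /(_ y yq)/implyP.
by apply/forall_inP => y yq; apply/implyP; apply: cl.
Qed.

(** Irreflexivity of adjacency is what keeps a common neighbour of q out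
    of q, so that w really adds a vertex. *)
Lemma is_clique_setU1 (G : sgraph) (q : {set vertex G}) (w : vertex G) :
  is_clique (w |: q) && (w \notin q) =
  is_clique q && (w \in \bigcap_(v in q) nbhd v).
Proof.
apply/andP/andP => [[/is_cliqueP cl wq] | [/is_cliqueP cl /bigcapP wN]].
  split; first by apply/is_cliqueP => x y xq yq; apply: cl; apply: setU1r.
  apply/bigcapP => v vq; rewrite inE; apply: cl; rewrite ?setU11 ?setU1r //.
  by apply: contraNneq wq => <-.
have adjw v : v \in q -> adj v w by move/wN; rewrite inE.
split; last by apply/negP => /adjw; rewrite adj_irrefl.
apply/is_cliqueP => x y /setU1P[-> | xq] /setU1P[-> | yq].
- by rewrite eqxx.
- by rewrite adj_sym adjw.
- by rewrite adjw.
- exact: cl.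
Qed.

(** Adding and deleting w are inverse bijections between the k-cliques whose
    vertices are all adjacent to w and the (k+1)-cliques through w. *)
Lemma sum_cliques_at_vertex (G : sgraph) (k : nat) (w : vertex G) :
  \sum_(q in cliques G k | w \in \bigcap_(v in q) nbhd v) 1 =
  \sum_(r in cliques G k.+1 | w \in r) 1.
Proof.
rewrite [RHS](reindex_onto (fun q => w |: q) (fun r => r :\ w)) /=; last first.
  by move=> r /andP[_ wr]; rewrite setD1K.
apply: eq_bigl => q; rewrite !inE eqxx andbT.
(* Deleting w from w |: q gives q back precisely when w is not in q. *)
have -> : ((w |: q) :\ w == q) = (w \notin q).
  by apply/eqP/idP => [<- | /setU1K //]; rewrite setD11.
rewrite andbAC -is_clique_setU1 [RHS]andbAC cardsU1.
by case: (w \notin q); rewrite ?andbF.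
Qed.

Theorem lemma2p5 (G : sgraph) (k : nat) (k_ge1 : 1 <= k) :
  \sum_(q in cliques G k) clique_val q = k.+1 * num_cliques G k.+1.
Proof.
have -> : k.+1 * num_cliques G k.+1 = \sum_(r in cliques G k.+1) #|r|.
  rewrite mulnC -sum_nat_const; apply: eq_bigr => r.
  by rewrite inE => /andP[_ /eqP].
under eq_bigr => q _ do rewrite /clique_val -sum1_card.
under [RHS]eq_bigr => r _ do rewrite -sum1_card.
rewrite (exchange_big_dep xpredT) //= [RHS](exchange_big_dep xpredT) //=.
by apply: eq_bigr => w _; apply: sum_cliques_at_vertex.
Qed.
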